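(* For every integer $v\equiv 1 \pmod 3$ with $v\neq 7$ (and $v\ge 4$), there exists a super-simple $2-(v,4,1)$ directed design $\mathcal{D}=(V,\mathcal{B})$ with $f(\mathcal{D})\geq \frac{1}{2}$; that is, every defining set of $\mathcal{D}$ contains at least $\frac{1}{2}|\mathcal{B}|$ blocks.
   Context: A $2-(v,k,\lambda)$ directed design (DD) is a pair $(V,\mathcal{B})$ where $V$ is a $v$-set and $\mathcal{B}$ is a collection of ordered $k$-tuples of distinct elements of $V$ (blocks) such that every ordered pair $(x,y)$ of distinct elements of $V$ appears in exactly $\lambda$ blocks; the pair $(x,y)$ appears in a block if both $x,y$ occur in it with $x$ occurring before $y$. The underlying design of a $2-(v,k,\lambda)$DD is the $2-(v,k,2\lambda)$ BIBD obtained by forgetting the order within each block. A $2-(v,k,\lambda)$DD is super-simple if any two blocks of its underlying BIBD intersect in at most two points. A defining set of a directed design $\mathcal{D}=(V,\mathcal{B})$ is a subset $S\subseteq\mathcal{B}$ that is contained in no other $2-(v,k,\lambda)$ directed design on $V$; a smallest defining set is a defining set of minimum cardinality. For a directed design $\mathcal{D}$, $f(\mathcal{D})$ denotes (size of a smallest defining set of $\mathcal{D}$)$/|\mathcal{B}|$.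
   Formalization: For v = 4 the design is not claimed to be super-simple: a 2-(4,4,1) directed design consists of two blocks on the same four points, which meet in 4 points, so none is super-simple; existence and f(D) ≥ 1/2 are still proved there. *)

(* Defs.v *)
From mathcomp Require Import all_boot all_order all_algebra.
Set Implicit Arguments.
Unset Strict Implicit.
Unset Printing Implicit Defensive.

Import Order.TTheory GRing.Theory Num.Theory.

Section DirectedDesigns.
Variables (V : finType) (k : nat).
Implicit Types (b : k.-tuple V) (B S : {set k.-tuple V}).

(* For blocks without repetition, [index] is the position in the block. *)
Definition appears (x y : V) b : bool :=
  [&& x \in b, y \in b & index x b < index y b].

(* 2-(#|V|, k, 1) directed designs.  With lambda = 1 and k >= 2 the collection
   of blocks has no repeated ordered block, so a set of blocks loses nothing. *)
Definition directed_design B : bool :=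
  [forall (b | b \in B), uniq b] &&
  [forall x, forall y, (x != y) ==> (#|[set b in B | appears x y b]| == 1)].

Definition points b : {set V} := [set x in b].

(* The blocks of the underlying BIBD are the [points b], b in B, counted with
   multiplicity: two ordered blocks on the same points form a repeated block,
   hence the condition b1 != b2 and not points b1 != points b2. *)
Definition super_simple B : bool :=
  [forall (b1 | b1 \in B), forall (b2 | b2 \in B),
    (b1 != b2) ==> (#|points b1 :&: points b2| <= 2)].

Definition defining_set B S : bool :=
  (S \subset B) &&
  [forall (B' | directed_design B'), (S \subset B') ==> (B' == B)].

(* B is a defining set of itself, which makes it a legitimate default. *)
Definition smallest_defining_set B : {set k.-tuple V} :=
  [arg min_(S < B | defining_set B S) #|S|].

Definition defining_ratio B : rat :=
  (#|smallest_defining_set B|%:R / #|B|%:R)%R.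

End DirectedDesigns.

(* Main.v *)
(* Suppose that a block b has x immediately before y and a block c has y
   immediately before x. Exchanging x and y in both leaves the covered ordered
   pairs unchanged, so every defining set contains b or c. If the blocks can be
   permuted so that each block forms such a trade with its image, then a defining
   set contains at least half of them.

   Designs with such a permutation are built by Wilson's fundamental construction.
   Write v = 3n + 1. A transversal design with six columns of size m, two of them
   truncated to s and t points, is a pairwise balanced design on n = 4m + s + t
   points with blocks of size 4, 5 and 6. Give every point weight 3, replace the
   blocks by directed group divisible designs of type 3^4, 3^5 and 3^6, and fill
   the columns, with one common extra point, by designs on 3m + 1, 3s + 1 and
   3t + 1 points. Super-simplicity and the permutation are inherited. The slopes
   of the transversal design exist over Z/m for m prime to 6 and over the field
   with 9 elements; finitely many small designs remain, given by base blocks under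
   a cyclic group. *)

Require Import Defs.
From Stdlib Require Import BinNat.
From mathcomp Require Import all_boot all_order all_algebra all_field.
From mathcomp Require Import perm zify.
Set Implicit Arguments.
Unset Strict Implicit.
Unset Printing Implicit Defensive.

(** * Ordered pairs, adjacency and trades in sequences *)

Section Sequences.
Variable T : eqType.
Implicit Types (x y u w : T) (b c s : seq T) (E : rel T).

(** The counterpart of [appears] for untyped-length sequences over any [eqType], so that one notion
    serves for blocks on ordinals, on [nat] and on [option (P * nat)]. *)
Definition before x y s := [&& x \in s, y \in s & index x s < index y s].

Definition adjacent s := zip s (behead s).

Definition trade b c := has (fun p => (p.2, p.1) \in adjacent c) (adjacent b).

(* [cs] is [bs] in another order such that corresponding blocks form a trade.
   The third condition is super-simplicity: two blocks with three common points
   order them oppositely, since no ordered pair is covered twice. *)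
Definition good E := exists bs cs : seq (seq T),
  [/\ all (fun b => (size b == 4) && uniq b) bs,
      forall x y, count (before x y) bs = E x y,
      forall b1 b2 x y z, b1 \in bs -> b2 \in bs ->
        before x y b1 -> before y z b1 -> before z y b2 -> before y x b2 -> false,
      perm_eq cs bs
    & all2 trade bs cs].

Lemma before_irr x s : before x x s = false.
Proof. by rewrite /before ltnn !andbF. Qed.

Lemma before_asym x y s : before x y s -> before y x s = false.
Proof. by case/and3P=> _ _ lt_xy; rewrite /before ltnNge ltnW // !andbF. Qed.

Lemma before_trans y x z s : before x y s -> before y z s -> before x z s.
Proof.
case/and3P=> xs ys lt_xy /and3P[_ zs lt_yz].
by rewrite /before xs zs (ltn_trans lt_xy).
Qed.

Lemma before_total x y s :
  x \in s -> y \in s -> x != y -> before x y s || before y x s.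
Proof.
move=> xs ys; rewrite /before xs ys /= -neq_ltn; apply: contraNN => /eqP eq_i.
by rewrite -(nth_index x xs) eq_i nth_index.
Qed.

Lemma adjacentP x y s : uniq s -> (x, y) \in adjacent s ->
  [/\ x \in s, y \in s & index y s = (index x s).+1].
Proof.
rewrite /adjacent; elim: s => [|a [|a' s] IHs] //= /andP[a_s uniq_s].
rewrite inE => /orP[/eqP[-> ->]|/(IHs uniq_s)[xs ys eq_i]].
  by rewrite !inE !eqxx orbT; move: a_s; rewrite inE negb_or; case: eqVneq.
have anx : a != x by apply: contraNneq a_s => ->.
have any : a != y by apply: contraNneq a_s => ->.
split; rewrite ?(in_cons a) ?xs ?ys ?orbT //.
by move: eq_i; rewrite /= (negPf anx) (negPf any) => ->.
Qed.

End Sequences.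

Section Swap.
Variable T : finType.
Implicit Types (x y u w : T) (s : seq T).

Lemma before_map_tperm x y u w s :
  before u w (map (tperm x y) s) = before (tperm x y u) (tperm x y w) s.
Proof.
have mem_s a : (a \in map (tperm x y) s) = (tperm x y a \in s).
  by rewrite -{1}(tpermK x y a) (mem_map perm_inj).
have idx_s a : index a (map (tperm x y) s) = index (tperm x y a) s.
  by rewrite -{1}(tpermK x y a) (index_map perm_inj).
by rewrite /before !mem_s !idx_s.
Qed.

(** Nothing lies between [x] and [y], so any third point compares with both of them alike and
    exchanging them changes only their mutual order. *)
Lemma before_swap x y u w s : uniq s -> (x, y) \in adjacent s ->
  (u, w) != (x, y) -> (u, w) != (y, x) ->
  before u w (map (tperm x y) s) = before u w s.
Proof.
move=> uniq_s /(adjacentP uniq_s)[xs ys eq_i]; rewrite before_map_tperm.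
have inj_i a a' : a \in s -> a' \in s -> index a s = index a' s -> a = a'.
  by move=> a_s a's eq_a; rewrite -(nth_index a a_s) eq_a nth_index.
rewrite !xpair_eqE /before.
case: tpermP => [->|->|/eqP unx /eqP uny]; case: tpermP => [->|->|/eqP wnx /eqP wny];
  rewrite ?eqxx ?xs ?ys //= ?ltnn // => _ _.
- by case ws: (w \in s) => //=; have := contra_neq (inj_i w y ws ys) wny; lia.
- by case ws: (w \in s) => //=; have := contra_neq (inj_i w y ws ys) wny; lia.
- by case us: (u \in s) => //=; have := contra_neq (inj_i u x us xs) unx; lia.
- by case us: (u \in s) => //=; have := contra_neq (inj_i u x us xs) unx; lia.
Qed.

End Swap.

(** * Trades and the lower bound for defining sets *)

Section DefiningSets.
Variable V : finType.
Implicit Types (x y u w : V) (b c t : 4.-tuple V) (B S : {set 4.-tuple V}).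

Lemma directed_designP B :
  reflect [/\ {in B, forall b, uniq b},
              forall x y, x != y -> exists2 b, b \in B & before x y b
            & forall x y b c, b \in B -> c \in B -> before x y b ->
                before x y c -> b = c]
          (directed_design B).
Proof.
apply: (iffP andP) => [[/forall_inP uniqB /forallP covB]|[uniqB covB eqB]].
  have cov1 x y : x != y -> exists b, [set b in B | appears x y b] = [set b].
    move=> neq_xy; have /forallP/(_ y)/implyP/(_ neq_xy) := covB x.
    by move/cards1P.
  split=> // [x y /cov1[b eq_b]|x y b c Bb Bc].
    have: b \in [set b in B | appears x y b] by rewrite eq_b set11.
    by rewrite inE => /andP[]; exists b.
  case: (eqVneq x y) => [->|/cov1[d eq_d] xy_b xy_c]; first by rewrite before_irr.
  have: b \in [set d] by rewrite -eq_d inE Bb.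
  have: c \in [set d] by rewrite -eq_d inE Bc.
  by move=> /set1P-> /set1P->.
split; first exact/forall_inP.
apply/forallP=> x; apply/forallP=> y; apply/implyP=> /covB[b Bb xy_b].
apply/cards1P; exists b; apply/setP=> c; rewrite !inE; apply/andP/eqP=> [[Bc xy_c]|->//].
exact: (eqB x y).
Qed.

Lemma third_point x y (s : seq V) :
  uniq s -> 2 < size s -> exists u, [/\ u \in s, u != x & u != y].
Proof.
move=> uniq_s size_s.
case: (altP (@allP _ (mem [:: x; y]) s)) => [/(uniq_leq_size uniq_s)|].
  by rewrite /= leqNgt size_s.
by case/allPn=> u su; rewrite !inE negb_or => /andP[]; exists u.
Qed.

(** If [S] avoided both blocks, exchanging [x] and [y] in them would give a second design through
    [S]. Most of the proof checks that the image is a design and that it differs from [B]. *)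
Lemma defining_set_trade B S b c :
    directed_design B -> defining_set B S -> b \in B -> c \in B -> trade b c ->
  (b \in S) || (c \in S).
Proof.
move=> dB /andP[sSB /forall_inP defS] Bb Bc.
case/hasP=> -[x y] /= adj_b adj_c; apply: contraT; rewrite negb_or => /andP[Sb Sc].
have [uniqB covB eqB] := directed_designP B dB.
have [xb yb ixy_b] := adjacentP (uniqB _ Bb) adj_b.
have [yc xc iyx_c] := adjacentP (uniqB _ Bc) adj_c.
have xy_b : before x y b by rewrite /before xb yb ixy_b /=.
have yx_c : before y x c by rewrite /before xc yc iyx_c /=.
have neq_xy : x != y by apply: contraTneq xy_b => ->; rewrite before_irr.
pose phi t := if (t == b) || (t == c) then map_tuple (tperm x y) t else t.
have phi_gen u w t : t \in B -> (u, w) != (x, y) -> (u, w) != (y, x) ->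
    before u w (phi t) = before u w t.
  move=> Bt uw1 uw2; rewrite /phi; case: ifP => // /orP[]/eqP->.
    by rewrite /= (before_swap (uniqB _ Bb) adj_b).
  by rewrite /= tpermC (before_swap (uniqB _ Bc) adj_c).
have phi_xy t : t \in B -> before x y (phi t) = (t == c).
  move=> Bt; rewrite /phi; case: eqP => [->|nb] /=.
    rewrite before_map_tperm tpermL tpermR (before_asym xy_b).
    by apply/esym; apply: contraTF xy_b => /eqP->; rewrite before_asym.
  case: eqP => [->|nc] /=; first by rewrite before_map_tperm tpermL tpermR.
  by apply/negP=> xy_t; case: nb; apply: eqB xy_t xy_b.
have phi_yx t : t \in B -> before y x (phi t) = (t == b).
  move=> Bt; rewrite /phi; case: eqP => [->|nb] /=.
    by rewrite before_map_tperm tpermL tpermR.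
  case: eqP => [->|nc] /=.
    by rewrite before_map_tperm tpermL tpermR before_asym.
  by apply/negP=> yx_t; case: nc; apply: eqB yx_t yx_c.
(* The exchange hands (x, y) over from [b] to [c] and (y, x) from [c] to [b]; every other pair stays
   with its block. *)
have phi_cov u w t : t \in B -> before u w (phi t) ->
    exists2 t0, t0 \in B & forall t', t' \in B -> before u w (phi t') -> t' = t0.
  case: (eqVneq (u, w) (x, y)) => [[-> ->] _ _|uw1].
    by exists c => // t' Bt'; rewrite phi_xy // => /eqP.
  case: (eqVneq (u, w) (y, x)) => [[-> ->] _ _|uw2 Bt uw_t].
    by exists b => // t' Bt'; rewrite phi_yx // => /eqP.
  move: uw_t; rewrite phi_gen // => uw_t.
  by exists t => // t' Bt'; rewrite phi_gen // => uw_t'; apply: eqB uw_t' uw_t.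
have dB' : directed_design (phi @: B).
  apply/directed_designP; split=> [_ /imsetP[t Bt ->]|u w neq_uw|].
  - rewrite /phi; case: ifP => _; last exact: uniqB.
    by rewrite /= (map_inj_uniq perm_inj) uniqB.
  - case: (eqVneq (u, w) (x, y)) => [[-> ->]|uw1].
      by exists (phi c); rewrite ?imset_f // phi_xy.
    case: (eqVneq (u, w) (y, x)) => [[-> ->]|uw2].
      by exists (phi b); rewrite ?imset_f // phi_yx.
    by have [t Bt uw_t] := covB _ _ neq_uw; exists (phi t); rewrite ?imset_f ?phi_gen.
  move=> u w _ _ /imsetP[t1 Bt1 ->] /imsetP[t2 Bt2 ->] uw1 uw2.
  by have [t0 _ eq_t] := phi_cov _ _ _ Bt1 uw1; rewrite (eq_t t1 Bt1 uw1) (eq_t t2 Bt2 uw2).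
have sSB' : S \subset phi @: B.
  apply/subsetP=> t St; suff <- : phi t = t by rewrite imset_f ?(subsetP sSB).
  by rewrite /phi; case: ifP => // /orP[]/eqP eq_t; rewrite -eq_t St in Sb Sc.
have eq_B : phi @: B = B by apply/eqP; exact: (implyP (defS _ dB')).
have Bb' : phi b \in B by rewrite -eq_B imset_f.
(* A third point [u] of [b] keeps its order relative to [x] in [phi b]. So [b] and [phi b] cover a
   common pair and, both lying in [B], coincide, although [phi b] has [y] before [x]. *)
have [u [ub unx uny]] : exists u, [/\ u \in tval b, u != x & u != y].
  by apply: third_point; rewrite ?uniqB ?size_tuple.
have nxu : x != u by rewrite eq_sym.
have eq_b : phi b = b.
  case/orP: (before_total xb ub nxu) => [xu_b|ux_b].
    by apply: (eqB x u) => //; rewrite phi_gen // xpair_eqE negb_and ?uny ?neq_xy ?orbT.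
  by apply: (eqB u x) => //; rewrite phi_gen // xpair_eqE negb_and ?unx ?uny.
by move: xy_b; rewrite -eq_b before_asym // phi_yx ?eqxx.
Qed.

(** The minimum in [smallest_defining_set] needs one defining set to start from. The first two
    entries of an extra block would form a pair that a block of [B] covers already. *)
Lemma defining_setxx B : 1 < #|V| -> directed_design B -> defining_set B B.
Proof.
move=> V_gt1 dB; rewrite /defining_set subxx /=.
apply/forall_inP=> B' dB'; apply/implyP=> sBB'; rewrite eqEsubset sBB' andbT.
have [uniqB' _ eqB'] := directed_designP _ dB'.
have [_ covB _] := directed_designP _ dB.
apply/subsetP=> b B'b; have := uniqB' b B'b.
case: b B'b => -[|x [|y s]] //= sz B'b; rewrite inE negb_or => /andP[/andP[nxy _] _].
have [c Bc xy_c] := covB x y nxy.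
suff -> : @Tuple 4 V [:: x, y & s] sz = c by [].
apply: eqB' xy_c => //; first exact: (subsetP sBB').
by rewrite /before /= !inE !eqxx orbT (negPf nxy).
Qed.

(** Double counting: every position contributes at least 1 to the sum of the two counts, which agree
    because [cs] permutes [bs]. *)
Lemma size_le_cover (P : pred (seq V)) (bs cs : seq (seq V)) :
  all2 (fun b c : seq V => P b || P c) bs cs -> perm_eq cs bs -> size bs <= (count P bs).*2.
Proof.
move=> cov_bc /seq.permP/(_ P) eq_count; rewrite -addnn -{2}eq_count.
elim: bs cs cov_bc {eq_count} => [|b bs IHbs] [|c cs] //= /andP[Pbc /IHbs].
by case/orP: Pbc => ->; case: (P _) => /=; lia.
Qed.

Lemma half_le_defining_ratio B (bs cs : seq (seq V)) :
    1 < #|V| -> directed_design B -> uniq bs ->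
    bs =i [seq tval b | b in B] -> perm_eq cs bs -> all2 (@trade V) bs cs ->
  (1 / 2 <= defining_ratio B)%R.
Proof.
move=> V_gt1 dB uniq_bs eq_bs perm_cs trades.
have BB : defining_set B B by apply: defining_setxx.
rewrite /defining_ratio /smallest_defining_set; case: arg_minnP => // S defS _.
have mem_bs b : (tval b \in bs) = (b \in B).
  by rewrite eq_bs mem_image //; exact: val_inj.
have size_bs : size bs = #|B|.
  rewrite -(size_image (@tval 4 V)); apply/perm_size/uniq_perm => //.
  by rewrite map_inj_in_uniq ?enum_uniq // => ? ? _ _; apply: val_inj.
pose P s := s \in [seq tval b | b in S].
have count_P : count P bs <= #|S|.
  rewrite -size_filter -(size_image (@tval 4 V)).
  by apply: uniq_leq_size; rewrite ?filter_uniq // => s; rewrite mem_filter => /andP[].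
have : size bs <= (count P bs).*2.
  apply: (size_le_cover (cs := cs)) => //.
  have cov l1 l2 : all2 (@trade V) l1 l2 -> all (mem bs) l1 -> all (mem bs) l2 ->
      all2 (fun b c : seq V => P b || P c) l1 l2.
    elim: l1 l2 => [|b l1 IH] [|c l2] //= /andP[bc tr] /andP[sb sl1] /andP[sc sl2].
    apply/andP; split; last exact: IH.
    move: sb sc bc; rewrite !eq_bs => /imageP[b' Bb' ->] /imageP[c' Bc' ->] bc.
    by rewrite /P !mem_image ?(defining_set_trade dB) //; exact: val_inj.
  by apply: cov => //; apply/allP=> c; rewrite /= ?(perm_mem perm_cs).
rewrite size_bs => leB.
have leB' : #|B| <= (#|S|).*2 by apply: leq_trans leB _; rewrite leq_double.
have B_gt0 : 0 < #|B|.
  have [x [y [_ _ nxy]]] := card_gt1P V_gt1.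
  have [_ covB _] := directed_designP _ dB.
  by have [b Bb _] := covB x y nxy; apply/card_gt0P; exists b.
rewrite Num.Theory.ler_pdivlMr ?Num.Theory.ltr0n // GRing.mul1r GRing.mulrC.
rewrite Num.Theory.ler_pdivrMr ?Num.Theory.ltr0n //.
by rewrite -GRing.natrM Num.Theory.ler_nat muln2.
Qed.

End DefiningSets.

Lemma count_le1_inj (T : eqType) (p : pred T) (s : seq T) b c :
  count p s <= 1 -> b \in s -> c \in s -> p b -> p c -> b = c.
Proof.
rewrite -size_filter => le1 bs cs pb pc.
have: b \in filter p s by rewrite mem_filter pb.
have: c \in filter p s by rewrite mem_filter pc.
by case: filter le1 => [|a [|]] //= _; rewrite !inE => /eqP-> /eqP->.
Qed.

(** * From lists of blocks to sets of tuples *)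

Section ListDesigns.
Variable V : finType.
Variables bs cs : seq (seq V).
Hypothesis bs_blocks : all (fun b => (size b == 4) && uniq b) bs.
Hypothesis bs_cover : forall x y, count (before x y) bs = (x != y).

Let B := [set b : 4.-tuple V | tval b \in bs].

Lemma before_inj x y b c :
  b \in bs -> c \in bs -> before x y b -> before x y c -> b = c.
Proof. by apply: count_le1_inj; rewrite bs_cover leq_b1. Qed.

(** A repeated block would cover its first two entries twice. *)
Lemma list_design_uniq : uniq bs.
Proof.
apply: count_mem_uniq => b; case bsb: (b \in bs); last by rewrite (count_memPn (negbT bsb)).
apply/eqP; rewrite eqn_leq -has_count has_pred1 bsb andbT.
have /andP[] := allP bs_blocks b bsb.
case: b bsb => [|x [|y s]] //= bsb _ /andP[]; rewrite inE negb_or => /andP[nxy _] _.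
apply: (leq_trans _ (leq_b1 (x != y))); rewrite -bs_cover.
by apply: sub_count => _ /eqP->; rewrite /before /= !inE !eqxx orbT /= (negPf nxy).
Qed.

Lemma mem_list_design : bs =i [seq tval b | b in B].
Proof.
move=> s; apply/idP/imageP => [bs_s|[b]]; last by rewrite inE => bs_b ->.
have /andP[sz _] := allP bs_blocks s bs_s.
by exists (Tuple sz); rewrite ?inE.
Qed.

Lemma list_directed_design : directed_design B.
Proof.
apply/directed_designP; split=> [b|x y nxy|x y b c].
- by rewrite inE => /(allP bs_blocks)/andP[].
- have: has (before x y) bs by rewrite has_count bs_cover nxy.
  case/hasP=> s; rewrite mem_list_design => /imageP[b Bb ->] xy_b.
  by exists b.
rewrite !inE => bs_b bs_c xy_b xy_c; apply: val_inj.
exact: before_inj xy_b xy_c.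
Qed.

Lemma list_super_simple :
  (forall b1 b2 x y z, b1 \in bs -> b2 \in bs ->
    before x y b1 -> before y z b1 -> before z y b2 -> before y x b2 -> false) ->
  super_simple B.
Proof.
move=> ssB; apply/forall_inP=> b1; rewrite inE => bs1.
apply/forall_inP=> b2; rewrite inE => bs2; apply/implyP=> neq_b.
rewrite leqNgt; apply/negP=> /card_gt2P[x [y [z [[]]]]].
rewrite !inE => /andP[x1 x2] /andP[y1 y2] /andP[z1 z2] [nxy nyz nzx].
have nxz : x != z by rewrite eq_sym.
have opp u w : u \in b1 -> u \in b2 -> w \in b1 -> w \in b2 -> u != w ->
    before u w b1 -> before w u b2.
  move=> u1 u2 w1 w2 nuw uw1.
  case/orP: (before_total u2 w2 nuw) => // uw2.
  by case/eqP: neq_b; apply: val_inj; apply: before_inj uw1 uw2.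
suff: false by [].
have oxy := opp x y x1 x2 y1 y2 nxy; have oyz := opp y z y1 y2 z1 z2 nyz.
have oxz := opp x z x1 x2 z1 z2 nxz; rewrite eq_sym in nxy.
rewrite eq_sym in nyz; rewrite eq_sym in nxz.
have oyx := opp y x y1 y2 x1 x2 nxy; have ozy := opp z y z1 z2 y1 y2 nyz.
have ozx := opp z x z1 z2 x1 x2 nxz; have bt := before_total.
(* Each of the six orders of the three points in [b1] is met by its reversal in [b2]. *)
case/orP: (bt _ _ _ _ x1 y1 (contra_neq (@esym _ _ _) nxy)) => [xy|yx].
  case/orP: (bt _ _ _ _ y1 z1 (contra_neq (@esym _ _ _) nyz)) => [yz|zy].
    exact: ssB bs1 bs2 xy yz (oyz yz) (oxy xy).
  case/orP: (bt _ _ _ _ x1 z1 (contra_neq (@esym _ _ _) nxz)) => [xz|zx].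
    exact: ssB bs1 bs2 xz zy (ozy zy) (oxz xz).
  exact: ssB bs1 bs2 zx xy (oxy xy) (ozx zx).
case/orP: (bt _ _ _ _ y1 z1 (contra_neq (@esym _ _ _) nyz)) => [yz|zy].
  case/orP: (bt _ _ _ _ x1 z1 (contra_neq (@esym _ _ _) nxz)) => [xz|zx].
    exact: ssB bs1 bs2 yx xz (oxz xz) (oyx yx).
  exact: ssB bs1 bs2 yz zx (ozx zx) (oyz yz).
exact: ssB bs1 bs2 zy yx (oyx yx) (ozy zy).
Qed.

Lemma list_half_le_defining_ratio :
    1 < #|V| -> perm_eq cs bs -> all2 (@trade V) bs cs ->
  (1 / 2 <= defining_ratio B)%R.
Proof.
move=> V_gt1; apply: half_le_defining_ratio => //.
- exact: list_directed_design.
- exact: list_design_uniq.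
- exact: mem_list_design.
Qed.

End ListDesigns.

(** * Unions of designs that cover disjoint relations *)

Section Gluing.
Variable T : eqType.
Implicit Types E F : rel T.

Lemma eq_good E F : E =2 F -> good E -> good F.
Proof.
by move=> eqE [bs [cs [? cov ? ? ?]]]; exists bs, cs; split=> // x y; rewrite -eqE.
Qed.

Lemma good0 : good (fun _ _ : T => false).
Proof. by exists [::], [::]. Qed.

Lemma all2_cat (r : seq T -> seq T -> bool) s1 s2 t1 t2 :
  all2 r s1 t1 -> all2 r s2 t2 -> all2 r (s1 ++ s2) (t1 ++ t2).
Proof. by elim: s1 t1 => [|x s1 IHs] [|y t1] //= /andP[-> /IHs h /h]. Qed.

(* Two blocks of different parts share at most one point, because the pairs of
   points of a block lie in the relation that the block belongs to. *)
Lemma goodU E F : symmetric E -> symmetric F -> (forall x y, E x y -> ~~ F x y) ->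
  good E -> good F -> good (fun x y => E x y || F x y).
Proof.
move=> symE symF disEF [bs [cs [blk_b cov_b ss_b perm_b tr_b]]].
case=> bs' [cs' [blk_b' cov_b' ss_b' perm_b' tr_b']].
exists (bs ++ bs'), (cs ++ cs'); split.
- by rewrite all_cat blk_b.
- move=> x y; rewrite count_cat cov_b cov_b'.
  by case xyE: (E x y) => //; rewrite (negPf (disEF _ _ xyE)).
- have inE x y b : b \in bs -> before x y b -> E x y.
    move=> bs_b xy_b; have: has (before x y) bs by apply/hasP; exists b.
    by rewrite has_count cov_b; case: (E x y).
  have inF x y b : b \in bs' -> before x y b -> F x y.
    move=> bs_b xy_b; have: has (before x y) bs' by apply/hasP; exists b.
    by rewrite has_count cov_b'; case: (F x y).
  move=> b1 b2 x y z; rewrite !mem_cat => /orP[b1b|b1b'] /orP[b2b|b2b'] xy yz zy yx.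
  + exact: ss_b xy yz zy yx.
  + by have := disEF x y (inE _ _ _ b1b xy); rewrite symF (inF _ _ _ b2b' yx).
  + by have := disEF y x (inE _ _ _ b2b yx); rewrite symF (inF _ _ _ b1b' xy).
  + exact: ss_b' xy yz zy yx.
- exact: perm_cat.
- exact: all2_cat.
Qed.

Lemma good_bigU (I : eqType) (r : seq I) (E : I -> rel T) :
    uniq r -> (forall i, i \in r -> symmetric (E i)) ->
    (forall i, i \in r -> good (E i)) ->
    (forall i j x y, i \in r -> j \in r -> E i x y -> E j x y -> i = j) ->
  good (fun x y => has (fun i => E i x y) r).
Proof.
elim: r => [|i r IHr] /=; first by move=> *; exact: good0.
case/andP=> i_r uniq_r symE goodE disE.
have sub_r j : j \in r -> j \in i :: r by rewrite inE orbC => ->.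
apply: goodU.
- exact/symE/mem_head.
- by move=> x y; apply: eq_in_has => j /sub_r/symE->.
- move=> x y xyE; apply/hasPn=> j rj; apply: contra i_r => xyEj.
  by rewrite (disE i j x y (mem_head i r) (sub_r j rj) xyE xyEj).
- exact/goodE/mem_head.
apply: IHr => // [j /sub_r/symE|j /sub_r/goodE|j k x y /sub_r rj /sub_r rk] //.
exact: disE.
Qed.

End Gluing.

(** * Renaming of points along a map injective on a domain *)

Section Transport.
Variables (T1 T2 : eqType) (h : T1 -> T2) (D : pred T1).
Hypothesis inj_h : {in D &, injective h}.

Lemma mem_map_in s x : {subset s <= D} -> x \in D -> (h x \in map h s) = (x \in s).
Proof.
move=> sD Dx; apply/mapP/idP => [[y sy]|sx]; last by exists x.
by move/(inj_h Dx (sD _ sy))=> ->.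
Qed.

Lemma index_map_in s x :
  {subset s <= D} -> x \in D -> index (h x) (map h s) = index x s.
Proof.
move=> + Dx; elim: s => //= y s IHs sD; rewrite IHs; last first.
  by move=> z sz; apply: sD; rewrite inE sz orbT.
by rewrite (inj_in_eq inj_h) // sD ?mem_head.
Qed.

Lemma before_map_in s x y : {subset s <= D} -> x \in D -> y \in D ->
  before (h x) (h y) (map h s) = before x y s.
Proof. by move=> sD Dx Dy; rewrite /before !mem_map_in ?index_map_in. Qed.

Lemma trade_map b c : trade b c -> trade (map h b) (map h c).
Proof.
have adj_map s : adjacent (map h s) = [seq (h p.1, h p.2) | p <- adjacent s].
  by rewrite /adjacent; case: s => [|x s] //=; elim: s x => //= y s IHs x; rewrite IHs.
case/hasP=> -[x y] /= bxy cyx; apply/hasP; exists (h x, h y).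
  by rewrite adj_map; apply/mapP; exists (x, y).
by rewrite adj_map; apply/mapP; exists (y, x).
Qed.

Lemma good_transport (E1 : rel T1) (E2 : rel T2) :
    (forall x y, E1 x y -> (x \in D) && (y \in D)) ->
    {in D &, forall x y, E2 (h x) (h y) = E1 x y} ->
    (forall u w, E2 u w -> exists x y, [/\ x \in D, y \in D, u = h x & w = h y]) ->
  good E1 -> good E2.
Proof.
move=> E1D E12 E2h [bs [cs [blk_b cov_b ss_b perm_b tr_b]]].
have inE1 x y b : b \in bs -> before x y b -> E1 x y.
  move=> bs_b xy_b; have: has (before x y) bs by apply/hasP; exists b.
  by rewrite has_count cov_b; case: (E1 x y).
(* A point of a block forms a covered pair with another point of it, and covered pairs lie in the
   domain. *)
have bsD b : b \in bs -> {subset b <= D}.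
  move=> bs_b x bx; have /andP[/eqP size_b uniq_b] := allP blk_b b bs_b.
  have /hasP[y by_ nxy]: has (fun y => x != y) b.
    apply: contraT => /hasPn all_x.
    suff: size b <= size [:: x] by rewrite size_b.
    apply: uniq_leq_size => // y by_; rewrite inE eq_sym.
    by have := all_x y by_; rewrite negbK.
  case/orP: (before_total bx by_ nxy).
    by move/(inE1 _ _ _ bs_b)/E1D=> /andP[].
  by move/(inE1 _ _ _ bs_b)/E1D=> /andP[].
have before_h u w b : b \in bs -> before u w (map h b) ->
    exists x y, [/\ x \in D, y \in D, u = h x, w = h y & before x y b].
  move=> bs_b uw; have /and3P[/mapP[x bx eq_u] /mapP[y by_ eq_w] _] := uw.
  exists x, y; rewrite !(bsD b bs_b) //; split=> //.
  by move: uw; rewrite eq_u eq_w before_map_in ?(bsD b bs_b) //; apply: bsD.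
exists (map (map h) bs), (map (map h) cs); split.
- rewrite all_map; apply/allP=> b bs_b /=.
  have /andP[size_b uniq_b] := allP blk_b b bs_b.
  rewrite size_map size_b map_inj_in_uniq // => x y bx by_.
  by apply: inj_h; apply: bsD bs_b _ _.
- move=> u w; rewrite count_map.
  case uw: (E2 u w).
    have [x [y [Dx Dy eq_u eq_w]]] := E2h u w uw.
    move: uw; rewrite eq_u eq_w E12 // => xyE1.
    transitivity (nat_of_bool (E1 x y)); last by rewrite xyE1.
    rewrite -cov_b.
    by apply: eq_in_count => b bs_b; rewrite /= before_map_in //; apply: bsD.
  apply/eqP; rewrite -leqn0 leqNgt -has_count; apply: contraFN uw => /hasP[b bs_b].
  case/(before_h _ _ _ bs_b)=> x [y [Dx Dy -> -> xy_b]].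
  by rewrite E12 // (inE1 x y b).
- move=> _ _ u w t /mapP[b1 bs1 ->] /mapP[b2 bs2 ->] uw wt tw wu.
  have [x [y [Dx Dy eu ew xy1]]] := before_h _ _ _ bs1 uw.
  have [y' [z [Dy' Dz ew' et yz1]]] := before_h _ _ _ bs1 wt.
  have eq_y : y' = y by apply: inj_h => //; rewrite -ew'.
  rewrite eq_y in yz1.
  apply: (ss_b _ _ _ _ _ bs1 bs2 xy1 yz1).
    by move: tw; rewrite et ew before_map_in //; apply: bsD.
  by move: wu; rewrite ew eu before_map_in //; apply: bsD.
- exact: perm_map.
move: tr_b; elim: (bs) (cs) => [|b bs' IH] [|c cs'] //= /andP[tr_bc /IH->].
by rewrite trade_map.
Qed.

End Transport.

(** * A computable test for developed designs *)

Section Pairs.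
Variable T : eqType.
Implicit Types (s : seq T).

Fixpoint pairs s : seq (T * T) :=
  if s is x :: s' then map (pair x) s' ++ pairs s' else [::].

Fixpoint triples s : seq (T * (T * T)) :=
  if s is x :: s' then map (pair x) (pairs s') ++ triples s' else [::].

Lemma mem_map_pair (U W : eqType) (a x : U) (y : W) (s : seq W) :
  ((x, y) \in map (pair a) s) = (x == a) && (y \in s).
Proof.
apply/mapP/andP => [[z sz [-> ->]] //|[/eqP-> sy]]; by exists y.
Qed.

Lemma mem_pairs s x y : uniq s -> ((x, y) \in pairs s) = before x y s.
Proof.
elim: s => [|a s IHs] //= /andP[a_s uniq_s]; rewrite mem_cat mem_map_pair IHs //.
rewrite /before !inE /= ![a == _]eq_sym; case: (eqVneq x a) => [->|nxa] /=.
  by rewrite (negPf a_s) orbF; case: (eqVneq y a) => [->|nya] /=;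
    rewrite ?(negPf a_s) ?andbT ?andbF.
by case: (eqVneq y a) => [->|nya] /=; rewrite ?(negPf a_s) ?andbF.
Qed.

Lemma pairs_uniq s : uniq s -> uniq (pairs s).
Proof.
elim: s => //= a s IHs /andP[a_s uniq_s]; rewrite cat_uniq IHs // andbT.
rewrite map_inj_uniq ?uniq_s => [|x y []//]; apply/hasPn=> -[x y].
by rewrite mem_pairs // mem_map_pair => /and3P[xs _ _]; apply: contraNN a_s => /andP[/eqP<-].
Qed.

Lemma mem_triples s x y z :
  uniq s -> ((x, (y, z)) \in triples s) = before x y s && before y z s.
Proof.
elim: s => [|a s IHs] //= /andP[a_s uniq_s].
rewrite mem_cat mem_map_pair mem_pairs // IHs // /before !inE /= ![a == _]eq_sym.
case: (eqVneq x a) => [->|nxa] /=; rewrite ?(negPf a_s) /= ?orbF;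
  case: (eqVneq y a) => [->|nya] /=; rewrite ?(negPf a_s) ?andbF ?andbT //=;
  case: (eqVneq z a) => [->|nza] /=; rewrite ?(negPf a_s) ?andbF ?andbT //=.
by case: (y \in s).
Qed.

Lemma count_before bs x y : all uniq bs ->
  count (before x y) bs = count_mem (x, y) (flatten (map pairs bs)).
Proof.
elim: bs => //= b bs IHbs /andP[uniq_b /IHbs->]; rewrite count_cat.
by rewrite (count_uniq_mem _ (pairs_uniq uniq_b)) mem_pairs.
Qed.

End Pairs.

(* The cyclic group generated by x |-> x + d mod m acts on the points below m and
   fixes the others. *)
Definition shift m d t x :=
  if x < m then let y := x + d * t in if y < m then y else y - m else x.

(* Consecutive blocks of a cycle, and its last and first block, form trades. *)
Definition develop m d r (cycles : seq (seq (seq nat))) :=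
  [seq map (map (shift m d t)) c | c <- cycles, t <- iota 0 r].

(** Moving the first block of each cycle to its end puts every block opposite its successor. *)
Definition rotate (cycles : seq (seq (seq nat))) := map (rot 1) cycles.

(** Sorting binary numbers and comparing neighbours avoids the quadratic cost of [uniq] under
    [vm_compute]. *)
Definition uniqN (s : seq N) := sorted N.ltb (sort N.leb s).

(** The base 128 exceeds every point number in use. Soundness rests only on distinct codes coming
    from distinct pairs. *)
Definition pair_code (p : nat * nat) :=
  N.add (N.mul (N.of_nat p.1) 128%num) (N.of_nat p.2).

(* A triple and its reversal have the same code, so that distinct codes rule out
   two blocks with three common points. *)
Definition triple_code (p : nat * (nat * nat)) :=
  let: (x, (y, z)) := p in
  if x < z then N.add (N.mul (pair_code (x, y)) 128%num) (N.of_nat z)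
  else N.add (N.mul (pair_code (z, y)) 128%num) (N.of_nat x).

Definition on_range v (e : rel nat) : rel nat :=
  fun x y => [&& x < v, y < v & e x y].

Definition check_design v (e : rel nat) (cycles : seq (seq (seq nat))) :=
  let bs := flatten cycles in
  let ps := flatten (map (@pairs nat) bs) in
  [&& all (fun b => [&& size b == 4, uniq b & all (fun x => x < v) b]) bs,
      all (fun p => e p.1 p.2) ps,
      uniqN (map pair_code ps),
      size ps == count (fun p => e p.1 p.2) [seq (x, y) | x <- iota 0 v, y <- iota 0 v]
    & all2 (@trade nat) bs (flatten (rotate cycles))].

Definition check_super_simple (cycles : seq (seq (seq nat))) :=
  uniqN (map triple_code (flatten (map (@triples nat) (flatten cycles)))).

Lemma uniqN_uniq s : uniqN s -> uniq s.
Proof.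
have tr : transitive N.ltb.
  move=> b a c /N.ltb_lt ab /N.ltb_lt bc.
  by apply/N.ltb_lt; apply: N.lt_trans ab bc.
move/(sorted_uniq tr (fun a => N.ltb_irrefl a)).
by rewrite sort_uniq.
Qed.

Section Check.
Variables (v : nat) (e : rel nat) (cycles : seq (seq (seq nat))).
Hypothesis check : check_design v e cycles.
Let bs := flatten cycles.
Let cs := flatten (rotate cycles).

Lemma check_blocks : all (fun b => (size b == 4) && uniq b) bs.
Proof. by case/and5P: check => + _ _ _ _; apply: sub_all => b /and3P[-> ->]. Qed.

(** The listed pairs are distinct, satisfy [e], and are as many as the pairs of [e] on the range, so
    the two lists have the same members. *)
Lemma check_cover x y : count (before x y) bs = on_range v e x y.
Proof.
case/and5P: check => blk inE /uniqN_uniq/map_uniq uniq_ps /eqP size_ps _.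
rewrite count_before; last by apply: sub_all check_blocks => b /andP[].
rewrite -/bs in blk inE uniq_ps size_ps *; rewrite count_uniq_mem //.
rewrite -size_filter in size_ps.
have mem_E p : (p \in [seq p <- [seq (x, y) | x <- iota 0 v, y <- iota 0 v] | e p.1 p.2]) =
    on_range v e p.1 p.2.
  rewrite mem_filter andbC /on_range andbA; congr (_ && _).
  case: p => a b; apply/allpairsP/andP => [[[a' b'] /= [+ + [-> ->]]]|[/= av bv]].
    by rewrite !mem_iota.
  by exists (a, b); rewrite !mem_iota.
have sub : {subset flatten (map (@pairs nat) bs) <=
    [seq p <- [seq (x, y) | x <- iota 0 v, y <- iota 0 v] | e p.1 p.2]}.
  move=> p ps_p; rewrite mem_E /on_range (allP inE p ps_p) andbT.
  case/flattenP: ps_p => _ /mapP[b bs_b ->]; case: p => a c.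
  have /and3P[_ uniq_b /allP b_v] := allP blk b bs_b.
  by rewrite mem_pairs // => /and3P[/b_v-> /b_v-> _].
have [_ eq_ps] := uniq_min_size uniq_ps sub (eq_leq (esym size_ps)).
by rewrite eq_ps mem_E.
Qed.

Lemma check_perm : perm_eq cs bs.
Proof.
rewrite /cs /bs; elim: cycles => //= c cycles' IH.
by apply: perm_cat => //; rewrite perm_rot.
Qed.

Lemma check_trades : all2 (@trade nat) bs cs.
Proof. by case/and5P: check. Qed.

Lemma triple_code_rev x y z : triple_code (x, (y, z)) = triple_code (z, (y, x)).
Proof. by rewrite /triple_code; case: ltngtP => // ->. Qed.

Lemma map_uniq_inj (T U : eqType) (f : T -> U) (s : seq T) :
  uniq (map f s) -> {in s &, injective f}.
Proof.
elim: s => //= a s IHs /andP[fa_s /IHs inj_s] x y; rewrite !inE.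
case/orP=> [/eqP->|sx] /orP[/eqP->|sy] //.
- by move=> eq_f; case/mapP: fa_s; exists y.
- by move=> eq_f; case/mapP: fa_s; exists x.
- exact: inj_s.
Qed.

(** A triple and its reversal both present would have equal codes, hence be equal, which forces
    [x = z]. *)
Lemma good_checked : check_super_simple cycles -> good (on_range v e).
Proof.
move/uniqN_uniq/map_uniq_inj=> inj_code.
exists bs, cs; split.
- exact: check_blocks.
- exact: check_cover.
- move=> b1 b2 x y z bs1 bs2 xy yz zy yx.
  have uniq_bs b : b \in bs -> uniq b by move=> /(allP check_blocks)/andP[].
  have t1 : (x, (y, z)) \in flatten (map (@triples nat) bs).
    by apply/flatten_mapP; exists b1; rewrite // mem_triples ?uniq_bs // xy.
  have t2 : (z, (y, x)) \in flatten (map (@triples nat) bs).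
    by apply/flatten_mapP; exists b2; rewrite // mem_triples ?uniq_bs // zy.
  have [eq_xz] := inj_code _ _ t1 t2 (triple_code_rev x y z).
  by move: (before_trans xy yz); rewrite eq_xz before_irr.
- exact: check_perm.
- exact: check_trades.
Qed.

End Check.

Definition complete n := on_range n (fun x y => x != y).

(** Type 3^k: the groups are the residue classes modulo [k], with three points each. *)
Definition gdd k := on_range (3 * k) (fun x y => x %% k != y %% k).

(** In the uses below [r * d = m], and [v] is [m], or [m + 1] with the last point fixed. Cycles have
    length two, except one of length three when the number of base blocks is odd. *)
Lemma good_developed v e m d r cycles :
  check_design v e (develop m d r cycles) && check_super_simple (develop m d r cycles) ->
  good (on_range v e).
Proof. by case/andP; apply: good_checked. Qed.

(** * Designs found by computer search *)

Lemma good_complete10 : good (complete 10).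
Proof.
apply: (@good_developed _ _ 10 2 5
    [:: [:: [:: 6; 0; 3; 5]; [:: 5; 3; 9; 8]; [:: 8; 9; 0; 6]]]); by vm_compute.
Qed.

Lemma good_gdd4 : good (gdd 4).
Proof.
apply: (@good_developed _ _ 12 4 3
    [:: [:: [:: 4; 5; 2; 11]; [:: 5; 4; 7; 6]];
     [:: [:: 7; 10; 4; 9]; [:: 2; 3; 9; 4]];
     [:: [:: 4; 3; 10; 1]; [:: 5; 10; 3; 8]]]); by vm_compute.
Qed.

Lemma good_complete13 : good (complete 13).
Proof.
apply: (@good_developed _ _ 13 1 13
    [:: [:: [:: 5; 6; 10; 3]; [:: 8; 7; 3; 10]]]); by vm_compute.
Qed.

Lemma good_gdd5 : good (gdd 5).
Proof.
apply: (@good_developed _ _ 15 1 15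
    [:: [:: [:: 4; 7; 5; 11]; [:: 12; 9; 11; 5]]]); by vm_compute.
Qed.

Lemma good_complete16 : good (complete 16).
Proof.
apply: (@good_developed _ _ 15 3 5
    [:: [:: [:: 2; 7; 15; 12]; [:: 9; 15; 7; 11]];
     [:: [:: 7; 14; 1; 13]; [:: 13; 1; 0; 11]];
     [:: [:: 7; 0; 3; 8]; [:: 3; 0; 9; 4]];
     [:: [:: 14; 8; 6; 5]; [:: 2; 5; 6; 13]]]); by vm_compute.
Qed.

Lemma good_gdd6 : good (gdd 6).
Proof.
apply: (@good_developed _ _ 18 2 9
    [:: [:: [:: 11; 4; 8; 9]; [:: 4; 11; 6; 14]];
     [:: [:: 13; 5; 14; 12]; [:: 10; 5; 13; 9]; [:: 14; 5; 10; 7]]]); by vm_compute.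
Qed.

Lemma good_complete19 : good (complete 19).
Proof.
apply: (@good_developed _ _ 19 1 19
    [:: [:: [:: 7; 17; 18; 12]; [:: 18; 17; 5; 2]; [:: 9; 5; 17; 7]]]); by vm_compute.
Qed.

Lemma good_complete22 : good (complete 22).
Proof.
apply: (@good_developed _ _ 22 2 11
    [:: [:: [:: 21; 9; 6; 14]; [:: 6; 9; 15; 10]];
     [:: [:: 11; 10; 7; 15]; [:: 0; 13; 15; 7]];
     [:: [:: 21; 2; 8; 19]; [:: 10; 8; 2; 20]; [:: 19; 8; 10; 9]]]); by vm_compute.
Qed.

Lemma good_complete25 : good (complete 25).
Proof.
apply: (@good_developed _ _ 25 1 25
    [:: [:: [:: 15; 14; 1; 19]; [:: 10; 0; 19; 1]];
     [:: [:: 21; 18; 24; 16]; [:: 14; 3; 16; 24]]]); by vm_compute.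
Qed.

Lemma good_complete28 : good (complete 28).
Proof.
apply: (@good_developed _ _ 27 3 9
    [:: [:: [:: 14; 5; 8; 18]; [:: 0; 5; 14; 20]];
     [:: [:: 4; 12; 23; 15]; [:: 12; 4; 21; 20]];
     [:: [:: 4; 18; 3; 9]; [:: 16; 11; 18; 4]];
     [:: [:: 22; 15; 5; 4]; [:: 26; 0; 15; 22]];
     [:: [:: 21; 17; 15; 19]; [:: 20; 15; 17; 25]];
     [:: [:: 17; 1; 27; 2]; [:: 0; 27; 1; 24]];
     [:: [:: 16; 10; 23; 13]; [:: 10; 16; 14; 1]]]); by vm_compute.
Qed.

Lemma good_complete31 : good (complete 31).
Proof.
apply: (@good_developed _ _ 31 1 31
    [:: [:: [:: 0; 15; 26; 18]; [:: 5; 1; 18; 26]];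
     [:: [:: 13; 29; 17; 18]; [:: 15; 17; 29; 8]; [:: 18; 17; 15; 24]]]); by vm_compute.
Qed.

Lemma good_complete34 : good (complete 34).
Proof.
apply: (@good_developed _ _ 34 2 17
    [:: [:: [:: 3; 7; 26; 0]; [:: 24; 7; 3; 16]];
     [:: [:: 25; 1; 26; 12]; [:: 10; 11; 26; 1]];
     [:: [:: 3; 6; 2; 21]; [:: 22; 0; 2; 6]];
     [:: [:: 15; 3; 23; 29]; [:: 21; 4; 3; 15]];
     [:: [:: 26; 15; 13; 20]; [:: 18; 8; 13; 15]; [:: 10; 20; 13; 8]]]); by vm_compute.
Qed.

Lemma good_complete37 : good (complete 37).
Proof.
apply: (@good_developed _ _ 37 1 37
    [:: [:: [:: 11; 32; 8; 2]; [:: 34; 2; 8; 16]];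
     [:: [:: 3; 27; 15; 19]; [:: 19; 15; 18; 8]];
     [:: [:: 2; 17; 19; 0]; [:: 17; 2; 3; 12]]]); by vm_compute.
Qed.

Lemma good_complete40 : good (complete 40).
Proof.
apply: (@good_developed _ _ 39 3 13
    [:: [:: [:: 37; 9; 17; 12]; [:: 9; 37; 32; 14]];
     [:: [:: 26; 35; 23; 7]; [:: 35; 26; 3; 28]];
     [:: [:: 18; 36; 17; 30]; [:: 30; 17; 23; 15]];
     [:: [:: 4; 36; 6; 7]; [:: 6; 36; 12; 8]];
     [:: [:: 17; 16; 25; 6]; [:: 18; 1; 6; 25]];
     [:: [:: 27; 24; 22; 1]; [:: 1; 22; 23; 37]];
     [:: [:: 19; 11; 26; 36]; [:: 8; 37; 26; 11]];
     [:: [:: 34; 33; 39; 25]; [:: 14; 39; 33; 8]];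
     [:: [:: 0; 17; 4; 29]; [:: 13; 17; 0; 21]];
     [:: [:: 13; 25; 23; 19]; [:: 8; 25; 13; 9]]]); by vm_compute.
Qed.

Lemma good_complete43 : good (complete 43).
Proof.
apply: (@good_developed _ _ 43 1 43
    [:: [:: [:: 21; 27; 38; 41]; [:: 35; 27; 21; 37]];
     [:: [:: 8; 9; 39; 21]; [:: 1; 9; 8; 41]];
     [:: [:: 28; 7; 12; 3]; [:: 12; 7; 35; 16]; [:: 9; 35; 7; 28]]]); by vm_compute.
Qed.

Lemma good_complete46 : good (complete 46).
Proof.
apply: (@good_developed _ _ 46 2 23
    [:: [:: [:: 36; 25; 1; 37]; [:: 31; 1; 25; 20]];
     [:: [:: 41; 24; 21; 3]; [:: 21; 24; 5; 23]];
     [:: [:: 14; 38; 33; 1]; [:: 42; 13; 1; 33]];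
     [:: [:: 4; 36; 18; 11]; [:: 1; 5; 11; 18]];
     [:: [:: 33; 2; 25; 10]; [:: 2; 33; 31; 32]];
     [:: [:: 44; 4; 20; 0]; [:: 28; 41; 0; 20]];
     [:: [:: 17; 14; 4; 8]; [:: 21; 2; 14; 17]; [:: 39; 4; 14; 2]]]); by vm_compute.
Qed.

Lemma good_complete49 : good (complete 49).
Proof.
apply: (@good_developed _ _ 49 1 49
    [:: [:: [:: 15; 11; 39; 31]; [:: 9; 17; 39; 11]];
     [:: [:: 47; 48; 35; 9]; [:: 4; 23; 35; 48]];
     [:: [:: 44; 34; 0; 27]; [:: 31; 35; 0; 34]];
     [:: [:: 0; 7; 47; 33]; [:: 47; 7; 36; 4]]]); by vm_compute.
Qed.

Lemma good_complete52 : good (complete 52).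
Proof.
apply: (@good_developed _ _ 51 3 17
    [:: [:: [:: 1; 48; 33; 25]; [:: 31; 33; 48; 7]];
     [:: [:: 21; 18; 34; 1]; [:: 18; 21; 7; 40]];
     [:: [:: 43; 13; 0; 6]; [:: 13; 43; 3; 48]];
     [:: [:: 27; 34; 51; 41]; [:: 41; 51; 0; 46]];
     [:: [:: 27; 50; 20; 31]; [:: 4; 3; 50; 27]];
     [:: [:: 46; 15; 23; 5]; [:: 23; 15; 16; 42]];
     [:: [:: 37; 50; 5; 28]; [:: 39; 20; 50; 37]];
     [:: [:: 8; 49; 4; 35]; [:: 46; 35; 4; 29]];
     [:: [:: 47; 4; 49; 20]; [:: 29; 4; 47; 33]];
     [:: [:: 43; 40; 41; 4]; [:: 37; 41; 40; 25]];
     [:: [:: 23; 45; 36; 24]; [:: 45; 23; 12; 14]];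
     [:: [:: 11; 27; 14; 26]; [:: 2; 27; 11; 9]];
     [:: [:: 6; 15; 27; 32]; [:: 47; 44; 32; 27]]]); by vm_compute.
Qed.

Lemma good_complete55 : good (complete 55).
Proof.
apply: (@good_developed _ _ 55 1 55
    [:: [:: [:: 40; 18; 31; 34]; [:: 7; 31; 18; 14]];
     [:: [:: 8; 34; 39; 20]; [:: 39; 34; 43; 40]];
     [:: [:: 3; 26; 5; 25]; [:: 52; 41; 5; 26]];
     [:: [:: 8; 53; 23; 51]; [:: 36; 16; 53; 8]; [:: 39; 23; 53; 16]]]); by vm_compute.
Qed.

Lemma good_complete58 : good (complete 58).
Proof.
apply: (@good_developed _ _ 58 2 29
    [:: [:: [:: 35; 2; 16; 29]; [:: 16; 2; 56; 22]];
     [:: [:: 25; 24; 8; 34]; [:: 50; 24; 25; 54]];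
     [:: [:: 11; 30; 21; 13]; [:: 13; 21; 14; 8]];
     [:: [:: 28; 7; 44; 56]; [:: 6; 1; 56; 44]];
     [:: [:: 50; 28; 39; 43]; [:: 28; 50; 37; 26]];
     [:: [:: 50; 27; 17; 53]; [:: 46; 36; 53; 17]];
     [:: [:: 33; 29; 17; 44]; [:: 37; 11; 44; 17]];
     [:: [:: 49; 7; 47; 19]; [:: 47; 7; 12; 20]];
     [:: [:: 34; 19; 53; 39]; [:: 39; 53; 56; 16]; [:: 54; 56; 53; 19]]]); by vm_compute.
Qed.

Lemma good_complete64 : good (complete 64).
Proof.
apply: (@good_developed _ _ 63 3 21
    [:: [:: [:: 19; 6; 21; 11]; [:: 6; 19; 9; 23]];
     [:: [:: 57; 46; 44; 54]; [:: 46; 57; 56; 42]];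
     [:: [:: 35; 29; 53; 37]; [:: 47; 53; 29; 43]];
     [:: [:: 14; 52; 21; 19]; [:: 57; 51; 21; 52]];
     [:: [:: 13; 6; 25; 53]; [:: 6; 13; 12; 42]];
     [:: [:: 41; 50; 39; 15]; [:: 39; 50; 10; 43]];
     [:: [:: 32; 35; 3; 48]; [:: 42; 44; 3; 35]];
     [:: [:: 61; 12; 50; 63]; [:: 50; 12; 47; 30]];
     [:: [:: 2; 44; 13; 32]; [:: 3; 28; 13; 44]];
     [:: [:: 52; 2; 23; 35]; [:: 63; 36; 2; 52]];
     [:: [:: 3; 45; 31; 54]; [:: 54; 31; 17; 46]];
     [:: [:: 26; 62; 61; 18]; [:: 17; 37; 18; 61]];
     [:: [:: 46; 9; 53; 5]; [:: 9; 46; 30; 21]];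
     [:: [:: 41; 4; 45; 5]; [:: 10; 5; 45; 53]];
     [:: [:: 52; 40; 57; 14]; [:: 62; 57; 40; 16]];
     [:: [:: 49; 13; 58; 55]; [:: 13; 49; 4; 7]]]); by vm_compute.
Qed.

Lemma good_complete67 : good (complete 67).
Proof.
apply: (@good_developed _ _ 67 1 67
    [:: [:: [:: 56; 30; 33; 1]; [:: 57; 33; 30; 43]];
     [:: [:: 3; 39; 28; 34]; [:: 28; 39; 20; 44]];
     [:: [:: 38; 34; 4; 22]; [:: 63; 22; 4; 5]];
     [:: [:: 50; 30; 29; 44]; [:: 54; 10; 44; 29]];
     [:: [:: 18; 9; 11; 39]; [:: 49; 56; 11; 9]; [:: 39; 11; 56; 43]]]); by vm_compute.
Qed.

(** * Wilson's construction *)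

Section CompleteOn.
Variable T : eqType.

Definition on_seq (s : seq T) : rel T := fun x y => [&& x \in s, y \in s & x != y].

Lemma on_seq_sym s : symmetric (on_seq s).
Proof. by move=> x y; rewrite /on_seq andbCA eq_sym. Qed.

Lemma good_on_seq s : uniq s -> good (complete (size s)) -> good (on_seq s).
Proof.
case: s => [_ _|x0 s0]; first by apply: eq_good (good0 T) => x y.
set s := x0 :: s0 => uniq_s.
apply: (good_transport (h := nth x0 s) (D := fun i => i < size s)).
- by move=> i j; rewrite !unfold_in => lt_i lt_j /eqP; rewrite nth_uniq // => /eqP.
- by move=> i j /and3P[? ? _]; apply/andP.
- move=> i j; rewrite !unfold_in => lt_i lt_j.
  by rewrite /on_seq !mem_nth ?nth_uniq // /complete /on_range lt_i lt_j.
move=> x y /and3P[sx sy _]; exists (index x s), (index y s).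
by rewrite !unfold_in !index_mem !nth_index.
Qed.

Lemma good_complete_size s : uniq s -> good (on_seq s) -> good (complete (size s)).
Proof.
move=> uniq_s; apply: (good_transport (h := index^~ s) (D := mem s)).
- by move=> x y sx sy eq_i; rewrite -(nth_index x sx) eq_i nth_index.
- by move=> x y /and3P[sx sy _]; apply/andP.
- move=> x y sx sy; rewrite /on_seq sx sy /complete /on_range !index_mem sx sy /=.
  by congr (~~ _); apply/eqP/eqP=> [eq_i|->//]; rewrite -(nth_index x sx) eq_i nth_index.
case: s uniq_s => [|x0 s0]; first by move=> _ i j /and3P[].
set s := x0 :: s0 => uniq_s i j /and3P[lt_i lt_j _].
by exists (nth x0 s i), (nth x0 s j); rewrite !index_uniq // !mem_nth.
Qed.

End CompleteOn.

Section Blowup.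
Variable P : eqType.
Implicit Types (A G X : seq P) (p q : P) (u w : option (P * nat)).

(** Weight 3: each point has three copies, and [None] is the extra point that accounts for the 1 in
    3n + 1. *)
Definition blowup G : seq (option (P * nat)) :=
  None :: [seq Some (p, i) | p <- G, i <- iota 0 3].

Lemma mem_blowup G p i : (Some (p, i) \in blowup G) = (p \in G) && (i < 3).
Proof.
rewrite inE; apply/allpairsP/andP => [[[q j] [Gq lt_j [-> ->]]]|[Gp lt_i]].
  by split=> //; move: lt_j; rewrite mem_iota.
by exists (p, i); rewrite mem_iota.
Qed.

Lemma size_blowup G : size (blowup G) = (3 * size G).+1.
Proof.
rewrite -[LHS]/(size [seq Some (p, i) | p <- G, i <- iota 0 3]).+1.
by rewrite size_allpairs size_iota mulnC.
Qed.

Lemma blowup_uniq G : uniq G -> uniq (blowup G).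
Proof.
move=> uniq_G; rewrite /blowup cons_uniq; apply/andP; split.
  by apply/allpairsP=> -[[p i] []].
by apply: allpairs_uniq => // -[p i] [q j] _ _ [-> ->].
Qed.

Definition cross A : rel (option (P * nat)) := fun u w =>
  if (u, w) is (Some (p, i), Some (q, j)) then
    [&& p \in A, q \in A, i < 3, j < 3 & p != q]
  else false.

Lemma cross_sym A : symmetric (cross A).
Proof.
case=> [[p i]|] [[q j]|] //; rewrite /cross [q == p]eq_sym.
by case: (p \in A); case: (q \in A); case: (i < 3); case: (j < 3).
Qed.

Lemma good_cross A : uniq A -> good (gdd (size A)) -> good (cross A).
Proof.
case: A => [_ _|p0 A0]; first by apply: eq_good (good0 _) => -[[? ?]|] [[? ?]|].
set A := p0 :: A0 => uniq_A; set k := size A.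
(* The residue modulo [k] selects the point and the quotient selects the copy, so the classes of
   [gdd k] become the triples of copies of one point. *)
pose h x := Some (nth p0 A (x %% k), x %/ k).
have ltk x : x %% k < k by rewrite ltn_mod.
have eq_nth x y : (nth p0 A (x %% k) == nth p0 A (y %% k)) = (x %% k == y %% k).
  by rewrite nth_uniq ?ltk.
apply: (good_transport (h := h) (D := fun x => x < 3 * k)).
- move=> x y _ _ [/eqP]; rewrite eq_nth => /eqP eq_m eq_d.
  by rewrite (divn_eq x k) (divn_eq y k) eq_m eq_d.
- by move=> x y /and3P[? ? _]; apply/andP.
- move=> x y; rewrite !unfold_in => lt_x lt_y.
  by rewrite /cross /h !mem_nth ?ltk // !ltn_divLR // lt_x lt_y eq_nth /gdd /on_range lt_x lt_y.
case=> [[p i]|] [[q j]|] // /and5P[Ap Aq lt_i lt_j _].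
have idx r : r \in A -> index r A < k by rewrite index_mem.
exists (i * k + index p A), (j * k + index q A); rewrite /h !unfold_in.
have k_gt0 : 0 < k by [].
rewrite !modnMDl !modn_small ?idx // !nth_index // !divnMDl // !divn_small ?idx // !addn0.
by split=> //; [have := idx p Ap | have := idx q Aq]; nia.
Qed.

(* With weight 3, group divisible designs replace the lines, and complete designs
   that share the point [None] replace the groups. *)
Lemma good_pbd (L I : eqType) (X : seq P) (gr : P -> I) (gs : seq I) (ls : seq L)
    (on : L -> pred P) :
    uniq X -> uniq gs -> uniq ls -> {in X, forall p, gr p \in gs} ->
    {in gs, forall i, good (complete (3 * count (fun p => gr p == i) X).+1)} ->
    {in ls, forall l, good (gdd (count (on l) X))} ->
    {in X &, forall p q, gr p != gr q -> exists2 l, l \in ls & on l p && on l q} ->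
    {in ls, forall l, {in X &, forall p q,
      on l p -> on l q -> p != q -> gr p != gr q}} ->
    {in ls &, forall l l', {in X &, forall p q, gr p != gr q ->
      on l p -> on l q -> on l' p -> on l' q -> l = l'}} ->
  good (complete (3 * size X).+1).
Proof.
move=> uniq_X uniq_gs uniq_ls gr_gs good_gs good_ls cov_ls cross_ls eq_ls.
rewrite -size_blowup; apply: good_complete_size; first exact: blowup_uniq.
pose E1 i := on_seq (blowup [seq p <- X | gr p == i]).
pose E2 l := cross [seq p <- X | on l p].
(* Pairs within a group, or with the extra point, come from [E1]; pairs across groups come from
   [E2]. *)
pose F u w := has (fun i => E1 i u w) gs || has (fun l => E2 l u w) ls.
have inE1 i p q a c : E1 i (Some (p, a)) (Some (q, c)) ->
    [/\ p \in X, q \in X, gr p = i & gr q = i].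
  case/and3P; rewrite !mem_blowup !mem_filter.
  by move=> /andP[/andP[/eqP-> ->] _] /andP[/andP[/eqP-> ->]].
have inE2 l u w : E2 l u w -> exists p q a c,
    [/\ u = Some (p, a), w = Some (q, c), p \in X /\ q \in X, on l p /\ on l q & p != q].
  case: u w => [[p a]|] [[q c]|] // /and5P[]; rewrite !mem_filter.
  by case/andP=> lp Xp /andP[lq Xq] _ _ npq; exists p, q, a, c.
apply: (@eq_good _ F).
  move=> u w; rewrite /F; apply/orP/idP.
    case=> [/hasP[i _ /and3P[]]|/hasP[l ls_l]].
      have sub v : v \in blowup [seq p <- X | gr p == i] -> v \in blowup X.
        by case: v => [[p a]|] //; rewrite !mem_blowup mem_filter => /andP[/andP[_ ->]].
      by move=> /sub Xu /sub Xw nuw; apply/and3P.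
    case: u w => [[p a]|] [[q c]|] // /and5P[]; rewrite !mem_filter.
    move=> /andP[_ Xp] /andP[_ Xq] lt_a lt_c npq.
    by rewrite /on_seq !mem_blowup Xp Xq lt_a lt_c /=; apply: contraNneq npq => -[->].
  case/and3P=> Xu Xw nuw.
  have inG i p a : p \in X -> a < 3 -> gr p = i ->
      Some (p, a) \in blowup [seq p <- X | gr p == i].
    by move=> Xp lt_a gr_p; rewrite mem_blowup mem_filter gr_p eqxx Xp.
  case: u w Xu Xw nuw => [[p a]|] [[q c]|] //; rewrite ?mem_blowup.
  - move=> /andP[Xp lt_a] /andP[Xq lt_c] nuw.
    (* Two copies of the same point fall under equal groups. *)
    case: (eqVneq (gr p) (gr q)) => [eq_gr|neq_gr].
      left; apply/hasP; exists (gr p); rewrite ?gr_gs //.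
      by apply/and3P; split=> //; apply: inG.
    right; have [l ls_l /andP[lp lq]] := cov_ls p q Xp Xq neq_gr.
    apply/hasP; exists l => //; rewrite /E2 /cross !mem_filter lp lq Xp Xq lt_a lt_c /=.
    by apply: contraNneq neq_gr => ->.
  - move=> /andP[Xp lt_a] _ _; left; apply/hasP; exists (gr p); rewrite ?gr_gs //.
    by apply/and3P; split=> //; apply: inG.
  - move=> _ /andP[Xp lt_a] _; left; apply/hasP; exists (gr q); rewrite ?gr_gs //.
    by apply/and3P; split=> //; apply: inG.
apply: goodU.
- by move=> u w; apply: eq_has => i; apply: on_seq_sym.
- by move=> u w; apply: eq_has => l; apply: cross_sym.
- move=> u w /hasP[i gs_i uw1]; apply/hasPn=> l ls_l; apply/negP=> uw2.
  have [p [q [a [c [eu ew [Xp Xq] [lp lq] npq]]]]] := inE2 _ _ _ uw2.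
  move: uw1; rewrite eu ew => /inE1[_ _ gp gq].
  by have := cross_ls l ls_l p q Xp Xq lp lq npq; rewrite gp gq eqxx.
- apply: good_bigU => // [i _|i gs_i|i j u w gs_i gs_j].
  + exact: on_seq_sym.
  + apply: good_on_seq; first by rewrite blowup_uniq ?filter_uniq.
    by rewrite size_blowup size_filter; apply: good_gs.
  (* All filled groups contain [None], so a covered pair determines its group through an endpoint
     other than [None]. *)
  have inG k v : v \in blowup [seq p <- X | gr p == k] -> v != None ->
      exists2 p, omap fst v = Some p & gr p = k.
    by case: v => [[p a]|] //; rewrite mem_blowup mem_filter => /andP[/andP[/eqP]]; exists p.
  case/and3P=> ui wi nuw /and3P[uj wj _].
  case: (eqVneq u None) => [u0|nu0].
    have nw0 : w != None by apply: contraNneq nuw => ->; rewrite u0.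
    have [p ep <-] := inG _ _ wi nw0; have [q + <-] := inG _ _ wj nw0.
    by rewrite ep => -[->].
  have [p ep <-] := inG _ _ ui nu0; have [q + <-] := inG _ _ uj nu0.
  by rewrite ep => -[->].
apply: good_bigU => // [l _|l ls_l|l l' u w ls_l ls_l' uw1 uw2].
- exact: cross_sym.
- by apply: good_cross; rewrite ?filter_uniq // size_filter; apply: good_ls.
have [p [q [a [c [eu ew [Xp Xq] [lp lq] npq]]]]] := inE2 _ _ _ uw1.
have [p' [q' [a' [c' [eu' ew' _ [lp' lq'] _]]]]] := inE2 _ _ _ uw2.
move: eu' ew' lp' lq'; rewrite eu ew => -[<- _] [<- _] lp' lq'.
by apply: (eq_ls l l' ls_l ls_l' p q) => //; apply: (cross_ls l).
Qed.

End Blowup.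

(** * Transversal designs *)

Definition good_order n := good (complete (3 * n).+1).

Section Transversal.
Import GRing.Theory.
Variables (R : finComUnitRingType) (x : nat -> R) (s t : nat).
Hypothesis x_unit : forall i j, i < j < 5 -> (x j - x i)%R \is a GRing.unit.

(* The lines y = a x + b on the columns x_0, ..., x_4, extended by their slope
   in column 5; columns 4 and 5 are truncated to s and t points. *)
Definition incident (l : R * R) (p : nat * R) : bool :=
  p.2 == if p.1 < 5 then (l.1 * x p.1 + l.2)%R else l.1.

(** For [j = 5] the second point prescribes the slope itself. *)
Definition line_through i j y z : R * R :=
  let a := if j < 5 then ((z - y) / (x j - x i))%R else z in (a, y - a * x i)%R.

(** Two points in different columns lie on exactly one line: the difference of the column parameters
    is a unit, so the slope is a quotient even over a ring with zero divisors. *)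
Lemma incident_line i j y z l : i < j < 6 ->
  (incident l (i, y) && incident l (j, z)) = (l == line_through i j y z).
Proof.
case: l => a b /andP[lt_ij lt_j]; rewrite /incident /line_through /=.
have -> : i < 5 by lia.
rewrite xpair_eqE; case: ifP => lt_j5.
  have u : (x j - x i)%R \is a GRing.unit by rewrite x_unit ?lt_ij.
  apply/andP/andP => [[/eqP-> /eqP->]|[/eqP-> /eqP->]].
    rewrite opprD addrACA subrr addr0 -mulrBr mulrK //; split=> //.
    by rewrite addrC addKr.
  rewrite addrC subrK; split=> //; rewrite addrA addrAC -mulrBr mulrVK //.
  by rewrite subrK.
apply/andP/andP => [[/eqP-> /eqP->]|[/eqP-> /eqP->]].
  by rewrite addrC addKr.
by rewrite addrC subrK.
Qed.

Definition column_size i := if i < 4 then #|R| else if i == 4 then s else t.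

Definition truncated_points : seq (nat * R) :=
  [seq (i, y) | i <- iota 0 6, y <- take (column_size i) (enum R)].

Hypotheses (le_s : s <= #|R|) (le_t : t <= #|R|).

Lemma column_size_le i : column_size i <= #|R|.
Proof. by rewrite /column_size; do 2!case: ifP => //. Qed.

Lemma count_truncated (a : pred (nat * R)) :
  count a truncated_points =
    \sum_(i < 6) count (fun y => a (val i, y)) (take (column_size i) (enum R)).
Proof.
rewrite /truncated_points count_flatten -map_comp sumnE big_map -(big_mkord xpredT
  (fun i => count (fun y => a (i, y)) (take (column_size i) (enum R)))).
by apply: eq_bigr => i _; rewrite /= count_map.
Qed.

Lemma truncated_points_uniq : uniq truncated_points.
Proof.
apply: allpairs_uniq_dep; first exact: iota_uniq.
  by move=> i _; apply/take_uniq/enum_uniq.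
by move=> [i y] [j z] _ _ /= [-> ->].
Qed.

Lemma truncated_points_col p : p \in truncated_points -> p.1 < 6.
Proof. by case/allpairsPdep=> i [y [+ _ ->]]; rewrite mem_iota. Qed.

Lemma count_column i : i < 6 -> count (fun p => p.1 == i) truncated_points = column_size i.
Proof.
move=> lt_i; rewrite count_truncated (bigD1 (Ordinal lt_i)) //= eqxx count_predT.
rewrite size_takel ?big1 ?addn0 // => [j nji|]; last by rewrite -cardE column_size_le.
rewrite (@eq_count _ _ pred0) ?count_pred0 // => y /=.
by apply/negbTE; apply: contraNneq nji => eq_ji; apply/eqP/val_inj.
Qed.

(** A line meets each of the four full columns once and each truncated column at most once. *)
Lemma count_line l : count (incident l) truncated_points \in [:: 4; 5; 6].
Proof.
rewrite count_truncated !big_ord_recr big_ord0 /= /column_size /=.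
have full f : count (fun y : R => incident l (f, y)) (take #|R| (enum R)) = 1.
  rewrite take_oversize -?cardE // /incident /=.
  by rewrite (count_uniq_mem _ (enum_uniq R)) mem_enum.
have part f n : count (fun y : R => incident l (f, y)) (take n (enum R)) <= 1.
  rewrite /incident /= (count_uniq_mem _ (take_uniq _ (enum_uniq R))).
  exact: leq_b1.
rewrite !full !inE; have := part 4 s; have := part 5 t.
by case: (count _ _) => [|[|]] //; case: (count _ _) => [|[|]].
Qed.

Lemma size_truncated : size truncated_points = 4 * #|R| + s + t.
Proof.
rewrite -count_predT count_truncated !big_ord_recr big_ord0 /= !count_predT.
by rewrite !size_takel -?cardE ?column_size_le // /column_size /=; lia.
Qed.

Lemma good_transversal :
  good_order #|R| -> good_order s -> good_order t -> good_order (4 * #|R| + s + t).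
Proof.
move=> good_R good_s good_t; rewrite /good_order -size_truncated.
apply: (@good_pbd _ (R * R)%type nat truncated_points fst (iota 0 6)
  (enum {: R * R}) incident).
- exact: truncated_points_uniq.
- exact: iota_uniq.
- exact: enum_uniq.
- by move=> p /truncated_points_col; rewrite mem_iota.
- move=> i; rewrite mem_iota /= add0n => lt_i; rewrite count_column //.
  by rewrite /column_size; case: ifP => _ //; case: ifP => _.
- move=> l _; have := count_line l; rewrite !inE.
  by case/or3P=> /eqP->; [apply: good_gdd4 | apply: good_gdd5 | apply: good_gdd6].
- move=> [i y] [j z] /truncated_points_col /= lt_i /truncated_points_col /= lt_j nij.
  case: (ltngtP i j) => [lt_ij|lt_ji|eq_ij]; last by rewrite eq_ij eqxx in nij.
    by exists (line_through i j y z); rewrite ?mem_enum // incident_line ?lt_ij.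
  exists (line_through j i z y); rewrite ?mem_enum // andbC incident_line ?lt_ji //.
- move=> l _ [i y] [j z] _ _ /= /eqP eq_y /eqP eq_z; apply: contraNneq => eq_ij.
  by move: eq_y eq_z; rewrite eq_ij /= => -> ->.
move=> l l' _ _ [i y] [j z] /truncated_points_col /= lt_i /truncated_points_col /= lt_j.
move=> nij li lj li' lj'.
case: (ltngtP i j) => [lt_ij|lt_ji|eq_ij]; last by rewrite eq_ij eqxx in nij.
  have := incident_line y z l; have := incident_line y z l'.
  move=> /(_ i j); rewrite li' lj' lt_ij lt_j => /(_ isT)/esym/eqP->.
  by move=> /(_ i j); rewrite li lj lt_ij lt_j => /(_ isT)/esym/eqP->.
have := incident_line z y l; have := incident_line z y l'.
move=> /(_ j i); rewrite li' lj' lt_ji lt_i => /(_ isT)/esym/eqP->.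
by move=> /(_ j i); rewrite li lj lt_ji lt_i => /(_ isT)/esym/eqP->.
Qed.

End Transversal.

(** With column parameters 0, ..., 4 the differences are at most 4, and these are units modulo [m]
    when 2 and 3 are. *)
Lemma good_coprime6 m s t : 1 < m -> coprime m 6 -> s <= m -> t <= m ->
  good_order m -> good_order s -> good_order t -> good_order (4 * m + s + t).
Proof.
move=> m_gt1 co_m6 le_s le_t good_m.
have card_m : #|'Z_m| = m by rewrite card_ord Zp_cast.
have co_m k : 0 < k < 5 -> coprime m k.
  have [co2 co3] : coprime m 2 /\ coprime m 3.
    by apply/andP; rewrite -coprimeMr.
  by case: k => [|[|[|[|[|]]]]] // _; rewrite ?coprimen1 // -[4]/(2 ^ 2) coprimeXr.
rewrite -{1}card_m; apply: (@good_transversal _ (fun i => i%:R)%R); rewrite ?card_m //.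
move=> i j /andP[lt_ij lt_j].
by rewrite -GRing.natrB 1?ltnW // unitZpE ?co_m //; lia.
Qed.

(** In a field any five distinct elements have invertible differences. This supplies columns of size
    9, which is not prime to 6. *)
Lemma good_prime_power p k s t : prime p -> 0 < k -> 5 <= p ^ k ->
    s <= p ^ k -> t <= p ^ k ->
  good_order (p ^ k) -> good_order s -> good_order t -> good_order (4 * p ^ k + s + t).
Proof.
move=> pr_p k_gt0; have [F _ <-] := PrimePowerField pr_p k_gt0.
move=> F_ge5 le_s le_t.
apply: (@good_transversal _ (nth 0%R (enum F))) => // i j /andP[lt_ij lt_j].
rewrite GRing.unitfE GRing.subr_eq0 nth_uniq ?enum_uniq -?cardE ?gtn_eqF //.
  exact: leq_trans F_ge5.
exact: leq_trans (ltn_trans lt_ij lt_j) F_ge5.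
Qed.

(** * Small orders and the recursion *)

Lemma good_order0 : good_order 0.
Proof.
apply: eq_good (good0 _) => x y; apply/esym/negbTE/and3P=> -[].
by case: x y => [|?] [|?].
Qed.

(** Order 20 has no listed design, since the recursion reaches it as 4 * 5. *)
Lemma good_order_small n : n < 23 -> n \notin [:: 1; 2; 20] -> good_order n.
Proof.
case: n => [|[|[|[|[|[|[|[|[|[|[|[|[|[|[|[|[|[|[|[|[|[|[|]]]]]]]]]]]]]]]]]]]]]]] // _ _;
  [exact: good_order0
  |exact: good_complete10
  |exact: good_complete13
  |exact: good_complete16
  |exact: good_complete19
  |exact: good_complete22
  |exact: good_complete25
  |exact: good_complete28
  |exact: good_complete31
  |exact: good_complete34
  |exact: good_complete37
  |exact: good_complete40
  |exact: good_complete43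
  |exact: good_complete46
  |exact: good_complete49
  |exact: good_complete52
  |exact: good_complete55
  |exact: good_complete58
  |exact: good_complete64
  |exact: good_complete67].
Qed.

(* Columns of size 1 or 2 are avoided, since they would have to be filled with
   super-simple designs on 4 or 7 points. *)
Lemma good_order_all n : n != 1 -> n != 2 -> good_order n.
Proof.
have [k le_nk] := ubnP n; elim: k n le_nk => // k IHk n /ltnSE le_nk n1 n2.
have IH j : j < n -> j != 1 -> j != 2 -> good_order j.
  by move=> lt_jn; apply: IHk; apply: leq_trans lt_jn le_nk.
have step m s t : coprime m 6 -> n = 4 * m + s + t -> 2 < m ->
    s <= m -> t <= m -> s != 1 -> s != 2 -> t != 1 -> t != 2 -> good_order n.
  by move=> co_m eq_n *; rewrite eq_n; apply: good_coprime6 => //; try apply: IH; lia.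
have step9 s t : n = 4 * 3 ^ 2 + s + t ->
    s <= 9 -> t <= 9 -> s != 1 -> s != 2 -> t != 1 -> t != 2 -> good_order n.
  by move=> eq_n *; rewrite eq_n; apply: good_prime_power => //; apply: IH; lia.
(* Halving the remaining 6 to 2m points gives two columns of size between 3 and [m], clear of the
   sizes 1 and 2. *)
have balanced_step m : coprime m 6 -> 2 < m -> 4 * m + 6 <= n <= 6 * m -> good_order n.
  move=> co_m m_gt2 /andP[le_n ge_n]; pose s := (n - 4 * m) %/ 2.
  by apply: (step m s (n - 4 * m - s)) => //; rewrite /s; lia.
case: (leqP 82 n) => [n_ge|n_lt82].
  (* With q = (n - 10) / 24 and m = 6q + 1, [n] lies between 24q + 10 = 4m + 6 and 24q + 33. The
     latter is at most 6m = 36q + 6 once q is at least 3, that is, from n = 82 on. *)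
  apply: (balanced_step (((n - 10) %/ 24) * 6 + 1)); try lia.
  by rewrite -coprime_modl modnMDl.
case: (leqP 74 n) => [n_ge|n_lt74]; first by apply: (balanced_step 17) => //; lia.
case: (leqP 58 n) => [n_ge|n_lt58]; first by apply: (balanced_step 13) => //; lia.
case: (leqP 50 n) => [n_ge|n_lt50]; first by apply: (balanced_step 11) => //; lia.
(* The gap between 6 * 7 = 42 and 4 * 11 + 6 = 50. Size 11 would leave 1 or 2 extra points for 45
   and 46 and is too large for 43; size 9 serves these three. *)
case: (leqP 43 n) => [n_ge|n_lt43].
  have : n \in iota 43 7 by rewrite mem_iota n_ge.
  rewrite !inE => /or4P[/eqP n_eq|/eqP n_eq|/eqP n_eq|/or4P[]/eqP n_eq].
  - exact: (step9 4 3).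
  - exact: (step 11 0 0).
  - exact: (step9 5 4).
  - exact: (step9 5 5).
  - exact: (step 11 3 0).
  - exact: (step 11 4 0).
  - exact: (step 11 5 0).
case: (leqP 34 n) => [n_ge|n_lt34]; first by apply: (balanced_step 7) => //; lia.
case: (leqP 31 n) => [n_ge|n_lt31].
  (* Three to five extra points cannot be split into two columns of at least 3, so one column is
     left empty. *)
  by apply: (step 7 (n - 28) 0) => //; lia.
case: (leqP 26 n) => [n_ge|n_lt26]; first by apply: (balanced_step 5) => //; lia.
case: (leqP 23 n) => [n_ge|n_lt23].
  by apply: (step 5 (n - 20) 0) => //; lia.
case: (eqVneq n 20) => [n_eq|n20]; first exact: (step 5 0 0).
by apply: good_order_small; rewrite ?inE ?negb_or ?n1 ?n2.
Qed.

Lemma good_design v : 1 < v -> good (complete v) ->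
  exists B : {set 4.-tuple 'I_v},
    [/\ directed_design B, super_simple B & (1 / 2 <= defining_ratio B)%R].
Proof.
move=> v_gt1 good_v.
have: good (fun i j : 'I_v => i != j).
  have := @good_on_seq 'I_v (enum 'I_v) (enum_uniq _); rewrite -cardE card_ord.
  by move/(_ good_v); apply: eq_good => i j; rewrite /on_seq !mem_enum.
case=> bs [cs [blk cov ss perm tr]]; exists [set b | tval b \in bs]; split.
- exact: list_directed_design.
- exact: list_super_simple.
- by apply: list_half_le_defining_ratio perm tr; rewrite ?card_ord.
Qed.

Lemma design4 : exists B : {set 4.-tuple 'I_4},
  directed_design B /\ (1 / 2 <= defining_ratio B)%R.
Proof.
pose o i lt_i := @Ordinal 4 i lt_i.
pose b := [:: o 0 isT; o 1 isT; o 2 isT; o 3 isT].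
pose bs := [:: b; rev b].
have blk : all (fun b => (size b == 4) && uniq b) bs by [].
have cov x y : count (before x y) bs = (x != y).
  by case: x y => [[|[|[|[|]]]] lt_x] // [[|[|[|[|]]]] lt_y].
exists [set b | tval b \in bs]; split; first exact: list_directed_design.
(* Rotating the list exchanges the block and its reverse, which form a trade at any adjacent
   pair. *)
by apply: (@list_half_le_defining_ratio _ bs (rot 1 bs)); rewrite ?card_ord // perm_rot.
Qed.

(* The directed designs with v = k = 4 are exactly the pairs of a block and its
   reverse; the two blocks have the same four points, so none of them is
   super-simple with multiplicities taken into account.  For v = 4 the guard
   [v <> 4] drops only this repetition condition: the underlying design has no
   two blocks that differ as sets of points. *)
Theorem theorem2p3 (v : nat) (v_mod3 : v = 1 %[mod 3]) (v_ge4 : 4 <= v)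
    (v_neq7 : v <> 7) :
  exists B : {set 4.-tuple 'I_v},
    [/\ directed_design B,
        v <> 4 -> super_simple B
      & (1 / 2 <= defining_ratio B)%R].
Proof.
case: (eqVneq v 4) => [->|v_neq4].
  by have [B [dB rB]] := design4; exists B.
have v_eq : v = (3 * (v %/ 3)).+1 by rewrite {1}(divn_eq v 3) v_mod3 mulnC addn1.
have good_v : good (complete v).
  (* Orders 1 and 2 would mean 4 and 7 points, both ruled out here. *)
  by rewrite v_eq; apply: good_order_all; apply/eqP => v3; lia.
have [|B [dB sB rB]] := good_design _ good_v; first by lia.
by exists B.
Qed.
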